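(* Let $A\in\mathbb R^{n\times n}$, $B\in\mathbb R^{n\times m}$, $C\in\mathbb R^{k\times n}$, $F\in\mathbb R^{\ell\times n}$, $x_0\in\mathbb R^n$, $y_c\in\mathbb R^k$, $y_e\in\mathbb R^\ell$, $S:=F^*F$. Assume that the algebraic Riccati equation $A^*X+XA-XBB^*X+C^*C=0$ has a stabilizing solution $P_+\in\mathbb R^{n\times n}$, i.e. all eigenvalues of $A_+:=A-BB^*P_+$ have negative real part. For $t_1>0$ let $P$, $w$, $x$ and $U$ be defined as in the context, let $x_h(t):=U(t)U(0)^{-1}x_0$ and $x_s:=A_+^{-1}BB^*A_+^{-*}C^*y_c$, and write $$x(t)=x_h(t)+x_s-e^{tA_+}A_+^{-1}BB^*A_+^{-*}C^*y_c+g(t,t_1),$$ which defines the remainder term $g(t,t_1)$. If, furthermore, the matrix $I+W(S-P_+)$ is invertible, where $W:=\int_0^\infty e^{sA_+}BB^*e^{sA_+^*}\,ds$, then for every fixed $t\in\mathbb R$ the remainder $g(t,t_1)$ decays to zero exponentially as $t_1\to\infty$.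
   Context: $M^*$ denotes the transpose and $M^{-*}:=(M^* )^{-1}$. For $t_1>0$: $P$ is the unique solution on $(-\infty,t_1]$ of the differential Riccati equation $-\dot P(t)=A^*P(t)+P(t)A-P(t)BB^*P(t)+C^*C$, $P(t_1)=S=F^*F$; $w$ is the solution of $-\dot w(t)=(A^*-P(t)BB^* )w(t)-C^*y_c$, $w(t_1)=-F^*y_e$; $x$ is the solution of $\dot x(t)=(A-BB^*P(t))x(t)-BB^*w(t)$, $x(0)=x_0$ (this is the optimal state of the problem of minimizing $\frac12\int_0^{t_1}\|Cx-y_c\|^2+\|u\|^2ds+\frac12\|Fx(t_1)-y_e\|^2$ subject to $\dot x=Ax+Bu$, $x(0)=x_0$); $U$ is the matrix solution of $\dot U(t)=(A-BB^*P(t))U(t)$, $U(t_1)=I$. All of these depend on $t_1$. ''Decays to zero exponentially as $t_1\to\infty$'' for fixed $t$ means that there are $c,\mu>0$ (possibly depending on $t$) with $\|g(t,t_1)\|\le c\,e^{-\mu t_1}$ for all $t_1>\max\{0,t\}$. *)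

(* Defs.v *)
From mathcomp Require Import all_boot all_order all_algebra.
From mathcomp Require Import all_classical all_reals all_analysis.
From mathcomp.real_closed Require Import complex.

Set Implicit Arguments.
Unset Strict Implicit.
Unset Printing Implicit Defensive.

Import Order.TTheory GRing.Theory Num.Theory.
Import numFieldNormedType.Exports.

Local Open Scope classical_set_scope.
Local Open Scope ring_scope.

Definition hurwitz (R : realType) (n : nat) (A : 'M[R]_n) : Prop :=
  forall z : R[i], eigenvalue (map_mx (real_complex R) A) z -> complex.Re z < 0.

(* [lim] is total; this series converges for every A. *)
Definition expmx (R : realType) (n : nat) (A : 'M[R]_n) : 'M[R]_n :=
  lim (series (fun j : nat => (j`!%:R)^-1 *: A ^+ j) @ \oo).

Definition stabilizing_solution (R : realType) (n m k : nat)
    (A : 'M[R]_n) (B : 'M[R]_(n, m)) (C : 'M[R]_(k, n)) (X : 'M[R]_n) : Prop :=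
  A^T *m X + X *m A - X *m B *m B^T *m X + C^T *m C = 0
  /\ hurwitz (A - B *m B^T *m X).

(* The entrywise integral is a Lebesgue integral; for Hurwitz A it converges
   absolutely and agrees with the improper Riemann integral. *)
Definition gramian (R : realType) (n m : nat) (A : 'M[R]_n) (B : 'M[R]_(n, m)) :
    'M[R]_n :=
  \matrix_(i, j) (\int[lebesgue_measure]_(s in `[0, +oo[)
     ((expmx (s *: A) *m B *m B^T *m expmx (s *: A^T)) i j))%R.

(* f' = rhs(t, f) on ]-oo, b], the derivative at b being the left derivative;
   the values of f beyond b are unconstrained. *)
Definition ode_sol_upto (R : realType) (p q : nat) (b : R)
    (rhs : R -> 'M[R]_(p, q) -> 'M[R]_(p, q)) (f : R -> 'M[R]_(p, q)) : Prop :=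
  (forall t : R, t < b -> is_derive t 1 f (rhs t (f t)))
  /\ h^-1 *: (f (b + h) - f b) @[h --> 0^'-] --> rhs b (f b).

(* Main.v *)
Require Import Defs.
From mathcomp Require Import all_boot all_order all_algebra.
From mathcomp Require Import all_classical all_reals all_analysis.
From mathcomp Require Import measurable_realfun spectral ring lra.
From mathcomp.real_closed Require Import complex.

Set Implicit Arguments.
Unset Strict Implicit.
Unset Printing Implicit Defensive.
Import Order.TTheory GRing.Theory Num.Theory.
Import numFieldNormedType.Exports.

Local Open Scope classical_set_scope.
Local Open Scope ring_scope.

(** Write [E t] for [e^(t Ap)], [G] for [B B^T], [Delta] for [S - Pp] and [tau] for
    the time to go [t1 - t].

    The remainder is controlled by a single vector. Put [ws = Ap^-T C^T yc], the
    steady adjoint state, [Q = P - Pp], [v = w - ws], and let [d] be the difference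
    between the optimal state and the homogeneous one. The remainder [g] and the
    combined costate [z = Q d + v] satisfy
      [g' = Ap g - G z],  [z' = - Ap^T z],  [g(0) = 0],  [z(0) = v(0)],
    a system with constant coefficients ([hamiltonian_pair]). The Gramian [W] solves
    the Lyapunov equation [Ap W + W Ap^T = - G] ([gramianE]), hence [g + W z] follows
    the flow of [Ap] and
      [g(t) = (E t W - W (E (-t))^T) v(0)]   ([decoupled_solution]).
    The horizon [t1] enters only through [v(0)], so it remains to see that [v(0)]
    decays exponentially in [t1].

    The same change of variable applied to [U] and its costate [Q U] gives
      [E tau U(t) = K(tau)], with [K(tau) = I + (W - E tau W (E tau)^T) Delta]
    ([transition_formula]). Since [Q] is symmetric, [U^T] is an integrating factor
    for the equation of [v], and integrating from [t1] down to [0] yields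
      [v(0) = (E t1)^T K(t1)^-T b(t1)]
    with [b] bounded ([adjoint_decay_formula]). The first factor decays because [Ap]
    is Hurwitz ([hurwitz_decay]). The second is bounded uniformly in [t1]
    ([invmx_bounded]): [K] is continuous, each [K(tau)] is invertible because the
    Riccati solution exists on the horizon [tau] ([transition_core_unit]), and the
    limit of [K] at infinity is the matrix [I + W (S - Pp)], invertible by
    assumption.

    The decay of [E t] rests on a quadratic Lyapunov function: over the complex
    numbers [Ap] is triangular in a suitable basis, and rescaling this basis makes
    the off-diagonal part negligible against the negative real parts on the diagonal
    ([hurwitz_dissipative]). *)

(** * Limits of matrix functions *)

Section MatrixLimits.
Context {R : realType}.

Lemma ler_mx_norm p q (M : 'M[R]_(p, q)) (c : R) :
  0 <= c -> (`|M| <= c) <-> (forall i j, `|M i j| <= c).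
Proof.
move=> c0; rewrite [`|M|]mx_normrE; split=> [h i j|h].
  by apply: le_trans h; apply: (le_bigmax _ (fun x => `|M x.1 x.2|) (i, j)).
by apply: bigmax_le => // -[i j] _; exact: h.
Qed.

Lemma mx_norm_entry p q (M : 'M[R]_(p, q)) i j : `|M i j| <= `|M|.
Proof. exact: ((ler_mx_norm M (normr_ge0 M)).1 (lexx _)). Qed.

(** The norm on matrices is the maximum of the entries, hence submultiplicative
    only up to the inner dimension. *)
Lemma mx_norm_mul p q r (M : 'M[R]_(p, q)) (N : 'M[R]_(q, r)) :
  `|M *m N| <= q%:R * `|M| * `|N|.
Proof.
apply/ler_mx_norm => [|i j]; first by rewrite !mulr_ge0.
rewrite mxE (le_trans (ler_norm_sum _ _ _))//.
apply: (@le_trans _ _ (\sum_(k < q) `|M| * `|N|)).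
  by apply: ler_sum => k _; rewrite normrM ler_pM// mx_norm_entry.
by rewrite sumr_const card_ord -mulrA mulr_natl.
Qed.

Lemma mx_norm_tr p q (M : 'M[R]_(p, q)) : `|M^T| = `|M|.
Proof.
apply/eqP; rewrite eq_le; apply/andP; split; apply/ler_mx_norm => // i j.
  by rewrite mxE mx_norm_entry.
by have := mx_norm_entry M^T j i; rewrite mxE.
Qed.

Lemma cvg_mxP (T : Type) (F : set_system T) {FF : Filter F} p q
    (f : T -> 'M[R]_(p, q)) (M : 'M[R]_(p, q)) :
  f @ F --> M <-> forall i j, (fun x => f x i j) @ F --> M i j.
Proof.
split=> [fM i j|fM].
  apply: (@continuous_cvg _ _ _ F _ _ (fun N : 'M[R]_(p, q) => N i j) _ _ fM).
  exact: coord_continuous.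
apply/cvgrPdist_le => e e0.
have : \forall x \near F, forall ij : 'I_p * 'I_q,
    `|M ij.1 ij.2 - f x ij.1 ij.2| <= e.
  apply: filter_forall => -[i j]; exact: ((cvgrPdist_le _ _).1 (fM i j)).
apply: filterS => x h; apply/ler_mx_norm => [|i j]; first exact: ltW.
by have := h (i, j); rewrite !mxE.
Qed.

Lemma cvg_mulmx (T : Type) (F : set_system T) {FF : Filter F} p q r
    (f : T -> 'M[R]_(p, q)) (g : T -> 'M[R]_(q, r))
    (M : 'M[R]_(p, q)) (N : 'M[R]_(q, r)) :
  f @ F --> M -> g @ F --> N -> (fun x => f x *m g x) @ F --> M *m N.
Proof.
move=> /cvg_mxP fM /cvg_mxP gN; apply/cvg_mxP => i j.
under eq_fun do rewrite mxE.
by rewrite mxE; apply: cvg_big => [|k _]; [exact: add_continuous|exact: cvgM].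
Qed.

Lemma cvg_trmx (T : Type) (F : set_system T) {FF : Filter F} p q
    (f : T -> 'M[R]_(p, q)) (M : 'M[R]_(p, q)) :
  f @ F --> M -> (fun x => (f x)^T) @ F --> M^T.
Proof.
move=> /cvg_mxP fM; apply/cvg_mxP => i j.
under eq_fun do rewrite mxE; rewrite mxE; exact: fM.
Qed.

Lemma cvg_det (T : Type) (F : set_system T) {FF : Filter F} p
    (f : T -> 'M[R]_p) (M : 'M[R]_p) :
  f @ F --> M -> (fun x => \det (f x)) @ F --> \det M.
Proof.
move=> /cvg_mxP fM; apply: cvg_big => [|s _]; first exact: add_continuous.
apply: cvgM; first exact: cvg_cst.
apply: cvg_big => [|i _]; [exact: mul_continuous|exact: fM].
Qed.

Lemma cvg_adj (T : Type) (F : set_system T) {FF : Filter F} p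
    (f : T -> 'M[R]_p) (M : 'M[R]_p) :
  f @ F --> M -> (fun x => \adj (f x)) @ F --> \adj M.
Proof.
move=> /cvg_mxP fM; apply/cvg_mxP => i j.
under eq_fun do rewrite mxE; rewrite mxE.
apply: cvgM; first exact: cvg_cst.
apply: cvg_det; apply/cvg_mxP => a b.
under eq_fun do rewrite !mxE; rewrite !mxE; exact: fM.
Qed.

(** By Cramer's rule the inverse is a rational function of the entries. *)
Lemma cvg_invmx (T : Type) (F : set_system T) {FF : Filter F} p
    (f : T -> 'M[R]_p) (M : 'M[R]_p) :
  M \in unitmx -> f @ F --> M -> (fun x => invmx (f x)) @ F --> invmx M.
Proof.
move=> Mu fM; have detM0 : \det M != 0 by rewrite -unitfE -unitmxE.
have dfM : \det (f x) @[x --> F] --> \det M by exact: cvg_det.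
have dinv : (fun x => (\det (f x))^-1 *: \adj (f x)) @ F --> invmx M.
  rewrite /invmx Mu; apply/cvg_mxP => i j.
  under eq_fun do rewrite mxE; rewrite mxE.
  apply: cvgM; first exact: (cvgV detM0 dfM).
  have : \adj (f x) @[x --> F] --> \adj M by exact: cvg_adj.
  by move/cvg_mxP; exact.
apply: cvg_trans dinv; apply: near_eq_cvg.
have : \forall x \near F, \det (f x) != 0.
  exact: (cvgr_neq0 (\det M)).
apply: filterS => x fx0.
by rewrite /invmx unitmxE unitfE fx0.
Qed.

(** Continuity bounds the inverse on every compact piece of the half-line, and
    an invertible limit bounds it near infinity. *)
Lemma invmx_bounded p (f : R -> 'M[R]_p) (M : 'M[R]_p) :
  continuous f -> f x @[x --> +oo] --> M -> M \in unitmx ->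
  (forall x, 0 <= x -> f x \in unitmx) ->
  exists2 c, 0 < c & forall x, 0 <= x -> `|invmx (f x)| <= c.
Proof.
move=> fc fM Mu fu.
have : \forall x \near +oo, `|invmx (f x)| <= `|invmx M| + 1.
  have /cvgrPdist_le/(_ 1 ltr01) : invmx (f x) @[x --> +oo] --> invmx M.
    exact: cvg_invmx.
  apply: filterS => x; rewrite distrC => h.
  by rewrite -lerBlDl (le_trans (lerB_dist _ _)).
move=> [a [_ ha]].
have gc : {within `[0, Num.max 0 a], continuous (fun x => `|invmx (f x)|)}.
  apply/subspace_continuousP => x /=; rewrite in_itv/= => /andP[x0 _].
  apply: cvg_within_filter; apply: cvg_norm; apply: cvg_invmx (fu _ x0) _.
  exact: fc.
have a0 : 0 <= Num.max 0 a by rewrite le_max lexx.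
have [b _ hb] := EVT_max a0 gc.
exists (`|invmx M| + 1 + `|invmx (f b)|) => [|x x0].
  by rewrite ltr_pwDl// ltr_pwDr.
have [xa|ax] := leP x (Num.max 0 a).
  by rewrite (le_trans (hb x _)) ?in_itv/= ?x0// lerDr addr_ge0.
rewrite (le_trans (ha x _)) ?lerDl//.
by move: ax; rewrite gt_max => /andP[].
Qed.

End MatrixLimits.

(** * Derivatives of matrix functions *)

Section MatrixDerivatives.
Context {R : realType}.

Lemma is_derive_mxP p q (M : R -> 'M[R]_(p, q)) (t : R) (dM : 'M[R]_(p, q)) :
  is_derive t 1 M dM <->
  forall i j, is_derive t 1 (fun x => M x i j) (dM i j).
Proof.
split=> [[Md MdM] i j|h].
  have := Md => /derivable_mxP/(_ i j) Mijd.
  by split=> //; rewrite -MdM derive_mx// mxE.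
have Md : derivable M t 1 by apply/derivable_mxP => i j; case: (h i j).
split=> //; rewrite derive_mx//; apply/matrixP => i j; rewrite mxE.
by case: (h i j).
Qed.

Lemma is_derive_mulmx p q r (M : R -> 'M[R]_(p, q)) (N : R -> 'M[R]_(q, r))
    (t : R) dM dN :
  is_derive t 1 M dM -> is_derive t 1 N dN ->
  is_derive t 1 (fun x => M x *m N x) (dM *m N t + M t *m dN).
Proof.
move=> /is_derive_mxP hM /is_derive_mxP hN; apply/is_derive_mxP => i j.
have -> : (fun x => (M x *m N x) i j) =
    \sum_(k < q) (fun x => M x i k) * (fun x => N x k j).
  by apply/funext => x; rewrite mxE fct_sumE.
have h k := is_deriveM (hM i k) (hN k j).
apply: is_derive_eq (is_derive_sum h) _.
rewrite !mxE -big_split/=; apply: eq_bigr => k _.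
by rewrite addrC; congr (_ + _); exact: mulrC.
Qed.

Lemma is_derive_mulmxl p q r (A : 'M[R]_(p, q)) (N : R -> 'M[R]_(q, r))
    (t : R) dN :
  is_derive t 1 N dN -> is_derive t 1 (fun x => A *m N x) (A *m dN).
Proof.
move=> hN; apply: is_derive_eq (is_derive_mulmx (is_derive_cst A t 1) hN) _.
by rewrite mul0mx add0r.
Qed.

Lemma is_derive_mulmxr p q r (N : R -> 'M[R]_(p, q)) (A : 'M[R]_(q, r))
    (t : R) dN :
  is_derive t 1 N dN -> is_derive t 1 (fun x => N x *m A) (dN *m A).
Proof.
move=> hN; apply: is_derive_eq (is_derive_mulmx hN (is_derive_cst A t 1)) _.
by rewrite mulmx0 addr0.
Qed.

Lemma is_derive_trmx p q (M : R -> 'M[R]_(p, q)) (t : R) dM :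
  is_derive t 1 M dM -> is_derive t 1 (fun x => (M x)^T) dM^T.
Proof.
move=> /is_derive_mxP hM; apply/is_derive_mxP => i j.
by under eq_fun do rewrite mxE; rewrite mxE.
Qed.

Lemma is_derive_mx_comp p q (M : R -> 'M[R]_(p, q)) (f : R -> R) (t : R) dM df :
  is_derive (f t) 1 M dM -> is_derive t 1 f df ->
  is_derive t 1 (fun x => M (f x)) (df *: dM).
Proof.
move=> /is_derive_mxP hM hf; apply/is_derive_mxP => i j; rewrite mxE.
rewrite mulrC; exact: (@is_derive1_comp _ (fun x => M x i j) f).
Qed.

Lemma is_derive_mx_continuous p q (M : R -> 'M[R]_(p, q)) (t : R) dM :
  is_derive t 1 M dM -> {for t, continuous M}.
Proof. by case=> Md _; exact/differentiable_continuous/derivable1_diffP. Qed.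

Lemma is_derive0_constant p q (M : R -> 'M[R]_(p, q)) (b : R) :
  (forall t, t < b -> is_derive t 1 M 0) ->
  forall s t, s < b -> t < b -> M s = M t.
Proof.
move=> M0 s t sb tb; apply/matrixP => i j.
wlog st : s t sb tb / s <= t.
  by move=> h; case: (leP s t) => [/h|/ltW/h] -> //.
have dM x : x \in `]s, t[ -> is_derive x 1 (fun x => M x i j) 0.
  rewrite in_itv/= => /andP[_ xt].
  by have /is_derive_mxP/(_ i j) := M0 x (lt_trans xt tb); rewrite mxE.
have cM : {within `[s, t], continuous (fun x => M x i j)}.
  apply: derivable_within_continuous => x; rewrite in_itv/= => /andP[_ xt].
  by have /is_derive_mxP/(_ i j)[] := M0 x (le_lt_trans xt tb).
have [x _] := MVT_segment st dM cM.
by rewrite mul0r => /subr0_eq ->.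
Qed.

Lemma is_derive0_constant_left p q (M : R -> 'M[R]_(p, q)) (b : R) :
  (forall t, t < b -> is_derive t 1 M 0) -> M x @[x --> b^'-] --> M b ->
  forall t, t < b -> M t = M b.
Proof.
move=> M0 Mb t tb; apply: (cvg_unique _ _ Mb) => //.
apply: (cvg_trans _ (@cvg_cst _ (M t) _ (b^'-) _)).
by apply: near_eq_cvg; near=> x; apply: (is_derive0_constant M0).
Unshelve. all: by end_near. Qed.

(** At the end of its interval a solution is only left-differentiable; left
    continuity is all that the uniqueness arguments use there. *)
Lemma left_quotient_continuous p q (M : R -> 'M[R]_(p, q)) (b : R)
    (L : 'M[R]_(p, q)) :
  h^-1 *: (M (b + h) - M b) @[h --> 0^'-] --> L ->
  M x @[x --> b^'-] --> M b.
Proof.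
move=> hL.
have shift : (fun x => x - b) @ b^'- `=>` 0^'-.
  move=> P [e e0 heP]; exists e => // x; rewrite /ball/= => xb x_lt_b.
  by apply: heP; rewrite /ball/= ?subr_lt0// sub0r opprB.
have x0 : (x - b) @[x --> b^'-] --> (0 : R).
  rewrite -[X in _ --> X](subrr b); apply: cvgB; last exact: cvg_cst.
  by apply: cvg_at_left_filter; exact: cvg_id.
have hM : (x - b) *: ((x - b)^-1 *: (M (b + (x - b)) - M b)) + M b
    @[x --> b^'-] --> 0 *: L + M b.
  apply: cvgD; last exact: cvg_cst.
  by apply: cvgZ => //; exact: (cvg_comp _ _ shift hL).
rewrite scale0r add0r in hM; apply: cvg_trans hM; apply: near_eq_cvg; near=> x.
have xb : x - b != 0.
  by rewrite subr_eq0 lt_eqF//; near: x; exact: nbhs_left_lt.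
by rewrite /= scalerA divff// scale1r subrKC subrK.
Unshelve. all: by end_near. Qed.

End MatrixDerivatives.

(** * The matrix exponential *)

Section MatrixExponential.
Context {R : realType} {n : nat}.
Implicit Type A : 'M[R]_n.

Lemma scalemx_exp (x : R) A k : (x *: A) ^+ k = x ^+ k *: A ^+ k.
Proof.
elim: k => [|k IH]; first by rewrite !expr0 scale1r.
by rewrite !exprS IH -!mulmxE -scalemxAl -scalemxAr scalerA.
Qed.

Lemma mx_norm_exp A k : `|A ^+ k| <= (n%:R * `|A|) ^+ k.
Proof.
elim: k => [|k IH]; rewrite ?expr0.
  by apply/ler_mx_norm => // i j; rewrite mxE; case: (_ == _);
    rewrite ?normr1 ?normr0.
rewrite exprS exprS; apply: le_trans (mx_norm_mul _ _) _.
by rewrite ler_wpM2l// mulr_ge0.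
Qed.

(** Coefficients of the scalar power series of an entry of [M e^(xA)]. Carrying
    the factor [M] makes the family stable under termwise differentiation, which
    turns [M] into [M A]; this gives access to the derivation theorem for scalar
    power series. *)
Definition expmx_coef p A (M : 'M[R]_(p, n)) i j (k : nat) : R :=
  (M *m A ^+ k) i j / k`!%:R.

(** Comparison with the exponential series of [n |A| |x|]. *)
Lemma is_cvg_expmx_coef p A (M : 'M[R]_(p, n)) i j x :
  cvgn (pseries (expmx_coef A M i j) x).
Proof.
apply: normed_cvg; rewrite /normed_series_of/=.
set a := n%:R * `|A| * `|x|.
apply: (@series_le_cvg _ _ (fun k => n%:R * `|M| * exp_coeff a k)) => [k|k|k|].
- exact: normr_ge0.
- by rewrite mulr_ge0 ?exp_coeff_ge0 ?mulr_ge0.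
- rewrite /exp_coeff/= /expmx_coef normrM normrM normrX normfV normr_nat.
  rewrite mulrAC (mulrA _ _ (_^-1)) ler_wpM2r ?invr_ge0//.
  rewrite [a]mulrC exprMn mulrCA mulrC.
  rewrite ler_wpM2l ?exprn_ge0// (le_trans (mx_norm_entry _ _ _))//.
  by rewrite (le_trans (mx_norm_mul _ _))// ler_wpM2l ?mulr_ge0 ?mx_norm_exp.
- exact: (@is_cvg_seriesZ _ _ (n%:R * `|M|) (is_cvg_series_exp_coeff a)).
Qed.

Lemma expmx_diffs p A (M : 'M[R]_(p, n)) i j :
  pseries_diffs (expmx_coef A M i j) = expmx_coef A (M *m A) i j.
Proof.
apply/funext => k; rewrite /pseries_diffs /expmx_coef exprS mulmxA factS natrM.
by rewrite invfM mulrCA mulVKf.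
Qed.

Lemma expmx_cvg A (x : R) :
  series (fun j : nat => (j`!%:R)^-1 *: (x *: A) ^+ j) @ \oo -->
  \matrix_(i, j) limn (pseries (expmx_coef A 1%:M i j) x).
Proof.
apply/cvg_mxP => i j; rewrite mxE.
rewrite (_ : (fun _ => _) = pseries (expmx_coef A 1%:M i j) x).
  exact: is_cvg_expmx_coef.
apply/funext => N; rewrite /pseries /series/= summxE; apply: eq_bigr => k _.
by rewrite scalemx_exp scalerA mxE /expmx_coef mul1mx [LHS]mulrC mulrA.
Qed.

Lemma expmxE A (x : R) :
  expmx (x *: A) = \matrix_(i, j) limn (pseries (expmx_coef A 1%:M i j) x).
Proof. exact: (cvg_lim _ (@expmx_cvg A x)). Qed.

Lemma mul_expmxE p A (M : 'M[R]_(p, n)) (x : R) :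
  M *m expmx (x *: A) = \matrix_(i, j) limn (pseries (expmx_coef A M i j) x).
Proof.
apply/matrixP => i j; rewrite expmxE !mxE; apply/esym/cvg_lim => //.
rewrite (_ : pseries _ _ = fun N =>
    \sum_k M i k * pseries (expmx_coef A 1%:M k j) x N).
  apply: cvg_big => [|k _]; first exact: add_continuous.
  apply: cvgM; first exact: cvg_cst.
  by rewrite mxE; exact: is_cvg_expmx_coef.
apply/funext => N; rewrite /pseries /series/=.
under [RHS]eq_bigr do rewrite mulr_sumr.
rewrite exchange_big/=; apply: eq_bigr => m _.
rewrite /expmx_coef mxE !mulr_suml; apply: eq_bigr => k _.
by rewrite mul1mx !mulrA.
Qed.

Lemma is_derive_expmx A (t : R) :
  is_derive t 1 (fun x => expmx (x *: A)) (A *m expmx (t *: A)).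
Proof.
rewrite mul_expmxE; apply/is_derive_mxP => i j; rewrite mxE.
rewrite (_ : (fun _ => _) = fun x => limn (pseries (expmx_coef A 1%:M i j) x)).
  have -> : expmx_coef A A i j = pseries_diffs (expmx_coef A 1%:M i j).
    by rewrite expmx_diffs mul1mx.
  apply: (@pseries_snd_diffs _ _ (`|t| + 1)); rewrite ?expmx_diffs;
    try exact: is_cvg_expmx_coef.
  by rewrite [ltRHS]ger0_norm ?addr_ge0// ltrDl.
by apply/funext => x; rewrite expmxE mxE.
Qed.

Lemma expmx0 : expmx (0 : 'M[R]_n) = 1%:M.
Proof.
have := expmxE 0 0; rewrite scale0r => ->; apply/matrixP => i j; rewrite mxE.
apply/cvg_lim => //; apply: cvg_near_cst; near=> N.
rewrite /pseries /series/=.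
have N0 : (0 < N)%N by near: N; exact: nbhs_infty_gt.
rewrite -(prednK N0) big_nat_recl// big1 => [|k _].
  by rewrite addr0 expr0 mulr1 /expmx_coef mul1mx expr0 fact0 divr1.
by rewrite expr0n mulr0.
Unshelve. all: by end_near. Qed.

Lemma expmx_comm A (t : R) : expmx (t *: A) *m A = A *m expmx (t *: A).
Proof.
rewrite mul_expmxE; apply/matrixP => i j; rewrite expmxE !mxE.
apply/esym/cvg_lim => //.
rewrite (_ : pseries _ _ = fun N =>
    \sum_k pseries (expmx_coef A 1%:M i k) t N * A k j).
  apply: cvg_big => [|k _]; first exact: add_continuous.
  apply: cvgM; last exact: cvg_cst.
  by rewrite mxE; exact: is_cvg_expmx_coef.
apply/funext => N; rewrite /pseries /series/=.
under [RHS]eq_bigr do rewrite mulr_suml.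
rewrite exchange_big/=; apply: eq_bigr => m _.
have Am : A *m A ^+ m = A ^+ m *m A by rewrite !mulmxE -exprS exprSr.
rewrite /expmx_coef Am mxE !mulr_suml; apply: eq_bigr => k _.
by rewrite mul1mx [RHS]mulrAC; congr (_ * _); rewrite mulrAC.
Qed.

Lemma expmx_tr A (t : R) : expmx (t *: A^T) = (expmx (t *: A))^T.
Proof.
apply/matrixP => i j; rewrite !expmxE !mxE; congr (limn (pseries _ _)).
apply/funext => k; rewrite /expmx_coef !mul1mx; congr (_ / _).
suff -> : A^T ^+ k = (A ^+ k)^T by rewrite mxE.
elim: k => [|k IH]; first by rewrite !expr0 trmx1.
by rewrite exprS IH exprSr trmx_mul.
Qed.

End MatrixExponential.

Section LinearODE.
Context {R : realType} {n : nat}.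
Implicit Type A : 'M[R]_n.

Lemma is_derive_expmx_sub A (b t : R) :
  is_derive t 1 (fun x => expmx ((b - x) *: A)) (- (A *m expmx ((b - t) *: A))).
Proof.
rewrite -scaleN1r.
apply: (@is_derive_mx_comp _ _ _ (fun x => expmx (x *: A)) (fun x => b - x)).
  exact: is_derive_expmx.
by rewrite -[X in is_derive _ _ _ X]sub0r; exact: is_deriveB.
Qed.

(** The generator [A] commutes with its exponential, so the two terms of the
    product rule cancel. *)
Lemma is_derive_pullback A q (y : R -> 'M[R]_(n, q)) (s t : R) :
  is_derive t 1 y (A *m y t) ->
  is_derive t 1 (fun x => expmx ((s - x) *: A) *m y x) 0.
Proof.
move=> dy; have := is_derive_mulmx (is_derive_expmx_sub A s t) dy.
by rewrite mulNmx mulmxA expmx_comm addNr.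
Qed.

(** The exponential is a solution itself, so its pullback along the flow keeps its
    value at [0]. *)
Lemma expmx_mulN A (t : R) : expmx (- t *: A) *m expmx (t *: A) = 1%:M.
Proof.
pose f x : 'M[R]_n := expmx ((0 - x) *: A) *m expmx (x *: A).
have f0 x : x < `|t| + 1 -> is_derive x 1 f 0.
  by move=> _; exact: is_derive_pullback (is_derive_expmx A x).
have := is_derive0_constant f0 (_ : t < `|t| + 1) (_ : 0 < `|t| + 1).
rewrite /f sub0r subrr scale0r expmx0 mul1mx => -> //.
  by rewrite (le_lt_trans (ler_norm t))// ltrDl.
Qed.

Lemma expmx_mulV A (t : R) : expmx (t *: A) *m expmx (- t *: A) = 1%:M.
Proof. by rewrite -[t in expmx (t *: A)]opprK expmx_mulN. Qed.

Lemma expmx_unit A (t : R) : expmx (t *: A) \in unitmx.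
Proof. by have /mulmx1_unit[] := expmx_mulV A t. Qed.

(** Uniqueness for the linear system: pulling a solution back along the flow
    gives a constant. *)
Lemma linear_ode A q (y : R -> 'M[R]_(n, q)) (b : R) :
  (forall t, t < b -> is_derive t 1 y (A *m y t)) ->
  forall s t, s < b -> t < b -> y t = expmx ((t - s) *: A) *m y s.
Proof.
move=> dy s t sb tb.
have d0 x : x < b -> is_derive x 1 (fun x => expmx ((t - x) *: A) *m y x) 0.
  by move=> /dy; exact: is_derive_pullback.
by have := is_derive0_constant d0 sb tb; rewrite subrr scale0r expmx0 mul1mx.
Qed.

Lemma linear_ode_left A q (y : R -> 'M[R]_(n, q)) (b : R) :
  (forall t, t < b -> is_derive t 1 y (A *m y t)) -> y x @[x --> b^'-] --> y b ->
  forall t, t < b -> y t = expmx ((t - b) *: A) *m y b.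
Proof.
move=> dy yb t tb.
have d0 x : x < b -> is_derive x 1 (fun x => expmx ((t - x) *: A) *m y x) 0.
  by move=> /dy; exact: is_derive_pullback.
have cb : expmx ((t - x) *: A) *m y x @[x --> b^'-]
    --> expmx ((t - b) *: A) *m y b.
  apply: cvg_mulmx => //; apply: cvg_at_left_filter.
  exact: is_derive_mx_continuous (is_derive_expmx_sub A t b).
have := is_derive0_constant_left d0 cb tb.
by rewrite subrr scale0r expmx0 mul1mx.
Qed.

End LinearODE.

(** * Exponential stability of Hurwitz matrices *)

Section ExponentialStability.
Context {R : realType}.

(** Schur's triangularization: the diagonal carries the eigenvalues. *)
Lemma hurwitz_trig n (A : 'M[R]_n) : hurwitz A ->
  exists Z T : 'M[R[i]]_n, [/\ Z \in unitmx,
    Z *m map_mx (real_complex R) A = T *m Z, is_trig_mx T &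
    forall i, complex.Re (T i i) < 0].
Proof.
case: n A => [|n] A hA.
  exists 1%:M, 0; split; rewrite ?unitmx1//; try by case.
    by apply/matrixP => -[].
  by apply/is_trig_mxP => -[].
set Ac := map_mx _ A.
have [Z Zu] := Schur Ac (ltn0Sn n).
have {}Zu : Z \in unitmx by exact: unitarymx_unit.
rewrite /similar_to/= conjumx// => Ttrig.
exists Z, (Z *m Ac *m invmx Z); split=> // [|i]; first by rewrite mulmxKV.
apply: hA.
have : eigenvalue (Z *m Ac *m invmx Z) ((Z *m Ac *m invmx Z) i i).
  rewrite eigenvalue_root_char char_poly_trig// /root horner_prod.
  by rewrite (bigD1 i)//= hornerXsubC subrr mul0r.
move: ((Z *m Ac *m invmx Z) i i) => a /eigenvalueP[v vT v0].
apply/eigenvalueP; exists (v *m Z).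
  by rewrite scalemxAl -vT !mulmxA mulmxKV.
apply: contra v0 => /eqP/(congr1 (mulmx^~ (invmx Z))).
by rewrite mulmxK// mul0mx => ->.
Qed.

Lemma Re_real_mul (r : R) (z : R[i]) :
  complex.Re (real_complex R r * z) = r * complex.Re z.
Proof. by case: z => a b /=; rewrite mul0r subr0. Qed.

Lemma Im_real_mul (r : R) (z : R[i]) :
  complex.Im (real_complex R r * z) = r * complex.Im z.
Proof. by case: z => a b /=; rewrite mul0r addr0. Qed.

(** Conjugation by the diagonal matrix of the powers of a small [d] multiplies
    the entry [(i, j)] by [d^(i-j)], so it shrinks the strictly lower part. *)
Lemma trig_rescale n (T : 'M[R[i]]_n) (eps : R) : 0 < eps -> is_trig_mx T ->
  exists D T' : 'M[R[i]]_n, [/\ D \in unitmx, D *m T = T' *m D,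
    forall i, T' i i = T i i &
    forall i j, i != j -> `|complex.Re (T' i j)| <= eps
                       /\ `|complex.Im (T' i j)| <= eps].
Proof.
move=> e0 /is_trig_mxP Ttrig.
pose m i j : R := `|complex.Re (T i j)| + `|complex.Im (T i j)|.
have m0 i j : 0 <= m i j by rewrite addr_ge0.
pose M : R := \sum_i \sum_j m i j.
have mM i j : m i j <= M.
  rewrite /M (bigD1 i)//= (bigD1 j)//= -addrA lerDl addr_ge0// sumr_ge0// => k _.
  by rewrite sumr_ge0.
have M0 : 0 <= M by rewrite sumr_ge0// => i _; rewrite sumr_ge0.
pose d : R := eps / (M + eps).
have Me : 0 < M + eps by rewrite ltr_wpDl.
have d0 : 0 < d by rewrite divr_gt0.
have d1 : d <= 1 by rewrite ler_pdivrMr// mul1r lerDr.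
have dM : d * M <= eps.
  by rewrite /d mulrAC ler_pdivrMr// ler_pM2l// lerDl ltW.
pose r (i j : 'I_n) : R := d ^+ i / d ^+ j.
exists (diag_mx (\row_i real_complex R (d ^+ i))),
  (\matrix_(i, j) (real_complex R (r i j) * T i j)).
have cd0 (i : 'I_n) : real_complex R (d ^+ i) != 0.
  by rewrite fmorph_eq0 expf_neq0// gt_eqF.
split.
- by rewrite unitmxE det_diag unitfE; apply/prodf_neq0 => i _; rewrite mxE.
- apply/matrixP => i j; rewrite mul_diag_mx mul_mx_diag !mxE mulrAC.
  by rewrite /r -rmorphM/= divfK// expf_neq0// gt_eqF.
- by move=> i; rewrite mxE /r divff ?expf_neq0 ?gt_eqF// rmorph1 mul1r.
- move=> i j ij; rewrite !mxE Re_real_mul Im_real_mul.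
  have [lt_ij|le_ji] := ltnP i j.
    by rewrite Ttrig//= !mulr0 normr0 ltW.
  have lt_ji : (j < i)%N by rewrite ltn_neqAle le_ji andbT eq_sym.
  have r0 : 0 <= r i j by rewrite /r divr_ge0 ?exprn_ge0 ?ltW.
  have rd : r i j <= d.
    rewrite /r -expfB// ?subn_gt0//.
    rewrite -(prednK (_ : 0 < i - j)%N) ?subn_gt0// exprS.
    by rewrite ger_pMr// exprn_ile1// ltW.
  have rM : r i j * m i j <= eps.
    by apply: le_trans dM; rewrite ler_pM.
  rewrite !(normrM (r i j)) (ger0_norm r0); split; apply: le_trans rM;
    by rewrite ler_wpM2l// ?lerDl ?lerDr.
Qed.

(** A lower triangular complex matrix with small off-diagonal entries is
    strictly dissipative; its realification [H] acts on pairs (real part,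
    imaginary part), and the complex basis change becomes the injection [K]. *)
Lemma hurwitz_dissipative n (A : 'M[R]_n) : hurwitz A ->
  exists (K : 'M[R]_(n + n, n)) (L : 'M[R]_(n, n + n)) (H : 'M[R]_(n + n))
    (mu : R), [/\ 0 < mu, L *m K = 1%:M, K *m A = H *m K &
    forall v : 'cV[R]_(n + n),
      (v^T *m (H *m v)) 0 0 <= - mu * (v^T *m v) 0 0].
Proof.
move=> /hurwitz_trig[Z0 [T0 [Z0u ZT0 T0trig T0neg]]].
have [mu mu0 muT] : exists2 mu : R, 0 < mu &
    forall i, complex.Re (T0 i i) <= - (mu + mu).
  (* The initial value 1 of the minimum serves the empty spectrum. *)
  exists (\big[Num.min/1]_(i < n) (- complex.Re (T0 i i)) / 2).
    rewrite divr_gt0//; elim/big_ind : _ => // [x y x0 y0|i _].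
      by rewrite lt_min x0.
    by rewrite oppr_gt0.
  by move=> i; rewrite -splitr lerNr; apply: bigmin_le_cond.
(* Off-diagonal entries bounded by [eps] contribute at most [2 n eps <= mu] times
   the squared norm, half of what the diagonal provides. *)
pose eps := mu / (2 * n.+1%:R).
have e0 : 0 < eps by rewrite divr_gt0// mulr_gt0.
have [D [T [Du DT Tdiag Toff]]] := trig_rescale e0 T0trig.
pose Z := D *m Z0.
have Zu : Z \in unitmx by rewrite unitmx_mul Du.
have ZT : Z *m map_mx (real_complex R) A = T *m Z.
  by rewrite /Z -mulmxA ZT0 !mulmxA DT.
pose re p q (N : 'M[R[i]]_(p, q)) := map_mx (@complex.Re R) N.
pose im p q (N : 'M[R[i]]_(p, q)) := map_mx (@complex.Im R) N.
have reM p q r (N : 'M[R[i]]_(p, q)) (N' : 'M[R[i]]_(q, r)) :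
    re _ _ (N *m N') = re _ _ N *m re _ _ N' - im _ _ N *m im _ _ N'.
  apply/matrixP => i j; rewrite !mxE raddf_sum -sumrB; apply: eq_bigr => k _.
  by rewrite !mxE; case: (N i k) (N' k j) => a b [].
have imM p q r (N : 'M[R[i]]_(p, q)) (N' : 'M[R[i]]_(q, r)) :
    im _ _ (N *m N') = re _ _ N *m im _ _ N' + im _ _ N *m re _ _ N'.
  apply/matrixP => i j; rewrite !mxE raddf_sum -big_split/=; apply: eq_bigr => k _.
  by rewrite !mxE; case: (N i k) (N' k j) => a b [].
have reA : re _ _ (map_mx (real_complex R) A) = A
  by apply/matrixP => i j; rewrite !mxE.
have imA : im _ _ (map_mx (real_complex R) A) = 0
  by apply/matrixP => i j; rewrite !mxE.
exists (col_mx (re _ _ Z) (im _ _ Z)),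
  (row_mx (re _ _ (invmx Z)) (- im _ _ (invmx Z))),
  (block_mx (re _ _ T) (- im _ _ T) (im _ _ T) (re _ _ T)), mu.
split=> //.
- rewrite mul_row_col mulNmx -reM mulVmx//; apply/matrixP => i j; rewrite !mxE.
  by case: (i == j).
- rewrite mul_col_mx mul_block_col mulNmx -reM addrC -imM -ZT reM imM reA imA.
  by rewrite !mulmx0 subr0 add0r.
move=> v; rewrite -[v]vsubmxK; move: (usubmx v) (dsubmx v) => a b.
rewrite mul_block_col tr_col_mx !mul_row_col !mulmxDr.
have quad (M : 'M[R]_n) (u u' : 'cV[R]_n) :
    (u^T *m (M *m u')) 0 0 = \sum_i \sum_k M i k * (u i 0 * u' k 0).
  rewrite mxE; apply: eq_bigr => i _; rewrite !mxE mulr_sumr.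
  by apply: eq_bigr => k _; rewrite mulrCA.
pose N (i : 'I_n) : R := a i 0 * a i 0 + b i 0 * b i 0.
have N0 i : 0 <= N i by rewrite addr_ge0// -expr2 sqr_ge0.
have NE : (a^T *m a + b^T *m b) 0 0 = \sum_i N i.
  by rewrite !mxE -big_split; apply: eq_bigr => i _; rewrite !mxE.
rewrite NE mxE [X in X + _]mxE [X in _ + X]mxE !quad -!big_split/=.
under eq_bigr do rewrite -!big_split/=.
(* Entrywise bound: the diagonal gains [2 mu], and each off-diagonal product is
   split by the inequality between geometric and arithmetic means. *)
apply: (@le_trans _ _ (\sum_i \sum_k
    ((i == k)%:R * (- (mu + mu) * N i) + eps * (N i + N k)))).
  apply: ler_sum => i _; apply: ler_sum => k _; rewrite !mxE.
  case: eqVneq => [<-|/Toff[]].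
    rewrite mul1r; have := muT i; rewrite -Tdiag => Ti.
    have := ler_wpM2r (N0 i) Ti; have := mulr_ge0 (ltW e0) (N0 i).
    rewrite /N; lra.
  rewrite mul0r add0r !ler_norml => /andP[t1 t2] /andP[t3 t4].
  move: t1 t2 t3 t4; rewrite /N.
  move: (complex.Re _) (complex.Im _) (a i 0) (a k 0) (b i 0) (b k 0).
  move=> p q a1 a2 b1 b2 p1 p2 q1 q2.
  have sq (c x y : R) : - eps <= c -> c <= eps ->
      c * (x * y) <= eps * (x * x + y * y) / 2.
    move=> c1 c2; have := mulr_ge0 (_ : 0 <= eps + c) (sqr_ge0 (x - y)).
    have := mulr_ge0 (_ : 0 <= eps - c) (sqr_ge0 (x + y)).
    rewrite subr_ge0 -lerBlDl sub0r c1 c2 => /(_ isT) + /(_ isT); lra.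
  have := sq p a1 a2 p1 p2; have := sq p b1 b2 p1 p2.
  have := sq q b1 a2 q1 q2; have := sq (- q) a1 b2 _ _.
  rewrite lerN2 lerNl q1 q2 => /(_ isT isT); lra.
have -> : \sum_i \sum_k
    ((i == k)%:R * (- (mu + mu) * N i) + eps * (N i + N k)) =
    - (mu + mu) * (\sum_i N i) + eps * (2 * n%:R) * (\sum_i N i).
  under eq_bigr => i _.
    rewrite big_split/= (bigD1 i)//= eqxx mul1r big1 ?addr0; last first.
      by move=> k /negPf; rewrite eq_sym => ->; rewrite mul0r.
    rewrite -mulr_sumr big_split/= sumr_const card_ord.
    over.
  rewrite big_split/= -mulr_sumr; congr (_ + _).
  rewrite -mulr_sumr big_split/= sumr_const card_ord -sumrMnl.
  by rewrite sumrMnl -mulr_natl; ring.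
have S0 : 0 <= \sum_i N i by rewrite sumr_ge0.
have en : eps * (2 * n%:R) <= mu.
  rewrite /eps mulrAC ler_pdivrMr ?mulr_gt0// ler_pM2l// ler_pM2l//.
  by rewrite ler_nat.
have := ler_wpM2r S0 en; lra.
Qed.

End ExponentialStability.

Section Decay.
Context {R : realType}.

(** The squared norm [N] of the solution satisfies [N' <= -2 mu N], so
    [e^(2 mu t) N(t)] does not increase. *)
Lemma dissipative_decay p (H : 'M[R]_p) (mu : R) (y : R -> 'cV[R]_p) :
  (forall v : 'cV[R]_p, (v^T *m (H *m v)) 0 0 <= - mu * (v^T *m v) 0 0) ->
  (forall t : R, is_derive t 1 y (H *m y t)) ->
  forall t i, 0 <= t ->
    `|y t i 0| <= Num.sqrt (((y 0)^T *m y 0) 0 0) * expR (- (mu * t)).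
Proof.
move=> Hdis dy t i t0.
pose N t := ((y t)^T *m y t) 0 0.
have N0 s : 0 <= N s.
  by rewrite /N mxE sumr_ge0// => k _; rewrite mxE -expr2 sqr_ge0.
pose f s := expR (2 * mu * s) * N s.
have dN (s : R) : is_derive s 1 N (2 * ((y s)^T *m (H *m y s)) 0 0).
  have /is_derive_mxP/(_ 0 0) := is_derive_mulmx (is_derive_trmx (dy s)) (dy s).
  move=> h; apply: (is_derive_eq h); rewrite mxE mulr_natl mulr2n; congr (_ + _).
  by rewrite !mxE; apply: eq_bigr => k _; rewrite !mxE mulrC.
have de (s : R) : is_derive s 1 (fun s => expR (2 * mu * s))
    (2 * mu * expR (2 * mu * s)).
  have -> : (fun s => expR (2 * mu * s)) = expR \o ( *%R (2 * mu)) by [].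
  apply: is_derive_eq (is_derive1_comp (is_derive_expR _)
    (_ : is_derive s 1 _ (2 * mu))) _.
    by have := is_deriveZ (2 * mu) (is_derive_id s (1 : R)); rewrite scaler1.
  by rewrite mulrC.
have df (s : R) : is_derive s 1 f (expR (2 * mu * s) *
    (2 * ((y s)^T *m (H *m y s)) 0 0 + 2 * mu * N s)).
  apply: is_derive_eq (is_deriveM (de s) (dN s)) _.
  by rewrite /GRing.scale/=; ring.
have cf : {within `[0, t], continuous f}.
  by apply: derivable_within_continuous => x _; case: (df x).
have [s _ fE] := MVT_segment t0 (fun x _ => df x) cf.
have ft : f t <= f 0.
  rewrite -subr_le0 fE subr0 mulr_le0_ge0// pmulr_rle0 ?expR_gt0//.
  by have := Hdis (y s); rewrite -/(N s); lra.
have NT : N t <= N 0 * expR (- (mu * t)) ^+ 2.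
  move: ft; rewrite /f mulr0 expR0 mul1r -ler_pdivlMl ?expR_gt0// -expRN mulrC.
  by rewrite -expRM_natl => /le_trans; apply; rewrite ler_wpM2l// ler_expR; lra.
rewrite -(@ler_pXn2r _ 2)// ?nnegrE ?mulr_ge0 ?sqrtr_ge0 ?expR_ge0//.
rewrite exprMn sqr_sqrtr ?(N0 0)// real_normK ?num_real//.
apply: le_trans NT; rewrite /N mxE (bigD1 i)//= mxE -expr2 lerDl.
by rewrite sumr_ge0// => k _; rewrite mxE -expr2 sqr_ge0.
Qed.

(** The injection [K] of [hurwitz_dissipative] sends the columns of [e^(tA)] to
    solutions of the dissipative system, and [L] brings the bound back. *)
Lemma hurwitz_decay n (A : 'M[R]_n) : hurwitz A ->
  exists c mu : R, [/\ 0 < c, 0 < mu &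
    forall t, 0 <= t -> `|expmx (t *: A)| <= c * expR (- (mu * t))].
Proof.
move=> /hurwitz_dissipative[K [L [H [mu [mu0 LK KA Hdis]]]]].
pose y j t : 'cV[R]_(n + n) := K *m expmx (t *: A) *m delta_mx j (0 : 'I_1).
have dy j (t : R) : is_derive t 1 (y j) (H *m y j t).
  rewrite /y !mulmxA -KA -[K *m A *m _]mulmxA.
  apply: is_derive_mulmxr; apply: is_derive_mulmxl; exact: is_derive_expmx.
pose c0 : R := \sum_j Num.sqrt (((y j 0)^T *m y j 0) 0 0).
have c0_ge0 : 0 <= c0 by rewrite sumr_ge0// => j _; exact: sqrtr_ge0.
have KE t : 0 <= t -> `|K *m expmx (t *: A)| <= c0 * expR (- (mu * t)).
  move=> t0; apply/ler_mx_norm => [|i j]; first by rewrite mulr_ge0 ?expR_ge0.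
  have -> : (K *m expmx (t *: A)) i j = y j t i 0.
    by rewrite /y -colE [RHS]mxE.
  apply: le_trans (dissipative_decay Hdis (dy j) i t0) _.
  rewrite ler_wpM2r ?expR_ge0// /c0 (bigD1 j)//= lerDl sumr_ge0//.
exists ((n + n)%:R * `|L| * c0 + 1), mu; split=> // [|t t0].
  by rewrite ltr_wpDl// !mulr_ge0.
rewrite -[expmx _]mul1mx -LK -mulmxA (le_trans (mx_norm_mul _ _))//.
rewrite mulrDl mul1r ler_wpDr ?expR_ge0// -[leRHS]mulrA ler_wpM2l ?mulr_ge0//.
exact: KE.
Qed.

End Decay.

(** * The Lyapunov equation and the Gramian *)

Section Lyapunov.
Context {R : realType} {n : nat}.
Implicit Types A X Y : 'M[R]_n.

Lemma cvg_exp_decay (c mu : R) : 0 < mu ->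
  c * expR (- (mu * t)) @[t --> +oo] --> (0 : R).
Proof.
move=> mu0; rewrite -[X in _ --> X](mulr0 c); apply: cvgM; first exact: cvg_cst.
have muy : (mu * t : R) @[t --> +oo] --> +oo by exact: gt0_cvgMry.
exact: (@cvg_comp _ _ _ (fun t : R => mu * t) (fun x => expR (- x)) _ _ _ muy
  (@cvgr_expR R)).
Qed.

Lemma cvg_decay p q (M : R -> 'M[R]_(p, q)) (c mu : R) : 0 < mu ->
  (forall t, 0 <= t -> `|M t| <= c * expR (- (mu * t))) ->
  M t @[t --> +oo] --> (0 : 'M[R]_(p, q)).
Proof.
move=> mu0 hM; apply: norm_cvg0.
apply: (squeeze_cvgr _ (cvg_cst 0) (cvg_exp_decay c mu0)).
near=> t; rewrite normr_ge0/=; apply: hM.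
by near: t; exact: nbhs_pinfty_ge.
Unshelve. all: by end_near. Qed.

Lemma hurwitz_unitmx A : hurwitz A -> A \in unitmx.
Proof.
move=> hA; rewrite unitmxE unitfE; apply/negP => /det0P[v v0 vA].
suff /hA : eigenvalue (map_mx (real_complex R) A) 0 by rewrite ltxx.
apply/eigenvalueP; exists (map_mx (real_complex R) v).
  by rewrite -map_mxM/= vA map_mx0 scale0r.
by rewrite map_mx_eq0.
Qed.

(** The congruence flow [t |-> e^(tA) X e^(tA^T)] has the Lyapunov operator as
    generator. *)
Lemma is_derive_congruence A X (t : R) :
  is_derive t 1 (fun s => expmx (s *: A) *m X *m (expmx (s *: A))^T)
    (expmx (t *: A) *m (A *m X + X *m A^T) *m (expmx (t *: A))^T).
Proof.
have dE := is_derive_expmx A t.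
have := is_derive_mulmx (is_derive_mulmxr X dE) (is_derive_trmx dE).
by rewrite -expmx_comm trmx_mul mulmxDr mulmxDl !mulmxA.
Qed.

Lemma cvg_congruence A X : hurwitz A ->
  expmx (t *: A) *m X *m (expmx (t *: A))^T @[t --> +oo] --> (0 : 'M[R]_n).
Proof.
move=> /hurwitz_decay[c [mu [c0 mu0 Emu]]].
have E0 : expmx (t *: A) @[t --> +oo] --> (0 : 'M[R]_n) by exact: cvg_decay Emu.
have -> : (0 : 'M[R]_n) = 0 *m X *m 0^T by rewrite !mul0mx.
apply: cvg_mulmx; last exact: cvg_trmx.
by apply: cvg_mulmx => //; exact: cvg_cst.
Qed.

(** A solution of the homogeneous equation is constant along the congruence flow,
    which tends to zero. *)
Lemma lyapunov_inj A X : hurwitz A -> A *m X + X *m A^T = 0 -> X = 0.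
Proof.
move=> hA AX; pose f t := expmx (t *: A) *m X *m (expmx (t *: A))^T.
have fX t : f t = X.
  have df s : s < `|t| + 1 -> is_derive s 1 f 0.
    by move=> _; have := is_derive_congruence A X s; rewrite AX mulmx0 mul0mx.
  have := is_derive0_constant df (_ : t < `|t| + 1) (_ : 0 < `|t| + 1).
  rewrite /f scale0r expmx0 mul1mx trmx1 mulmx1 => -> //.
    by rewrite (le_lt_trans (ler_norm t))// ltrDl.
have fc : f t @[t --> +oo] --> X.
  by rewrite (_ : f = fun=> X); [exact: cvg_cst|apply/funext => t; rewrite fX].
by apply: (cvg_unique _ fc (cvg_congruence X hA)).
Qed.

(** In finite dimension, injectivity of the Lyapunov operator is enough. *)
Lemma lyapunov_solvable A Y : hurwitz A -> exists X, A *m X + X *m A^T = Y.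
Proof.
move=> hA; pose L : 'M[R]_(n * n) := lin_mulmx A + lin_mulmxr A^T.
have LE X : mxvec X *m L = mxvec (A *m X + X *m A^T).
  by rewrite /L mulmxDr !mul_vec_lin linearD.
have Lu : L \in unitmx.
  rewrite unitmxE unitfE; apply/negP => /det0P[v v0 vL].
  move: vL; rewrite -[v]vec_mxK LE -(linear0 mxvec) => /(can_inj mxvecK).
  move=> /(lyapunov_inj hA) v'; move: v0.
  by rewrite -[v]vec_mxK v' linear0 eqxx.
exists (vec_mx (mxvec Y *m invmx L)); apply: (can_inj mxvecK).
by rewrite -LE vec_mxK mulmxKV.
Qed.

(** The transpose solves the same equation. *)
Lemma lyapunov_sym A X Y : hurwitz A -> Y^T = Y ->
  A *m X + X *m A^T = Y -> X^T = X.
Proof.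
move=> hA YT AX; apply/eqP; rewrite -subr_eq0; apply/eqP/(lyapunov_inj hA).
have AXT : A *m X^T + X^T *m A^T = Y.
  by rewrite -YT -AX linearD/= !trmx_mul trmxK addrC.
by rewrite mulmxBr mulmxBl addrACA -opprD AX AXT subrr.
Qed.

End Lyapunov.

Section Gramian.
Context {R : realType}.
Local Notation mu := (@lebesgue_measure R).

Lemma integral_itvy_ge0_primitive (g G : R -> R) (l : R) :
  (forall x, 0 <= x -> 0 <= g x) -> continuous g ->
  (forall x : R, is_derive x 1 G (g x)) -> G x @[x --> +oo] --> l ->
  mu.-integrable `[0, +oo[ (EFin \o g) /\
  \int[mu]_(x in `[0, +oo[) g x = l - G 0.
Proof.
move=> g0 cg dG Gl.
have cG : continuous G.
  by move=> x; exact/differentiable_continuous/derivable1_diffP/ex_derive.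
have ftc : (\int[mu]_(x in `[0%R, +oo[) (g x)%:E = l%:E - (G 0)%:E)%E.
  apply: ge0_continuous_FTC2y => //.
  - exact: continuous_subspaceT.
  - by apply: cvg_at_right_filter; exact: cG.
  - by move=> x _; rewrite derive1E derive_val.
split; last by rewrite /Rintegral ftc -EFinB.
apply/integrableP; split.
  apply/measurable_EFinP/measurable_funTS.
  exact: continuous_measurable_fun.
under eq_integral => x.
  rewrite inE/= in_itv/= andbT => x0.
  rewrite /= ger0_norm ?g0//.
  over.
by rewrite ftc -EFinB ltry.
Qed.

(** Adding the dominating exponential makes the integrand nonnegative, which
    reduces the improper integral to monotone convergence. *)
Lemma Rintegral_exp_dominated (f F : R -> R) (c nu l : R) : 0 < nu ->
  continuous f -> (forall x : R, is_derive x 1 F (f x)) ->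
  (forall x, 0 <= x -> `|f x| <= c * expR (- (nu * x))) ->
  F x @[x --> +oo] --> l ->
  \int[mu]_(x in `[0, +oo[) f x = l - F 0.
Proof.
move=> nu0 cf dF fe Fl.
pose e x := c * expR (- (nu * x)).
pose E x := - (c / nu) * expR (- (nu * x)).
have dE (x : R) : is_derive x 1 E (e x).
  have dn : is_derive x 1 (fun x => - (nu * x)) (- nu).
    have := is_deriveN (is_deriveZ nu (is_derive_id x (1 : R))).
    by rewrite scaler1.
  apply: is_derive_eq (is_deriveZ (- (c / nu))
    (is_derive1_comp (is_derive_expR _) dn)) _.
  rewrite /e /GRing.scale/= mulrCA mulrNN divfK ?gt_eqF//.
  by rewrite mulrC.
have ce : continuous e.
  move=> x; apply: cvgM; first exact: cvg_cst.
  apply: continuous_comp; last exact: continuous_expR.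
  by apply: cvgN; apply: cvgM; [exact: cvg_cst|exact: cvg_id].
have e0 x : 0 <= x -> 0 <= e x by move=> /fe; apply: le_trans.
have [ie Ie] := integral_itvy_ge0_primitive e0 ce dE (cvg_exp_decay _ nu0).
have fe0 x : 0 <= x -> 0 <= (f \+ e) x.
  by move=> /fe; rewrite ler_norml => /andP[+ _]; rewrite /= /e; lra.
have cfe : continuous (f \+ e).
  by move=> x; apply: cvgD; [exact: cf|exact: ce].
have dFE (x : R) : is_derive x 1 (F \+ E) ((f \+ e) x) by exact: is_deriveD.
have FEl : (F \+ E) x @[x --> +oo] --> l + 0.
  by apply: cvgD => //; exact: cvg_exp_decay.
have [ife Ife] := integral_itvy_ge0_primitive fe0 cfe dFE FEl.
have -> : f = (fun x => (f \+ e) x - e x) by apply/funext => x; rewrite /= addrK.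
rewrite RintegralB// Ie Ife/=; ring.
Qed.

(** The integrand is the derivative of minus the congruence flow of [X], which
    decays from [X] to zero. *)
Lemma gramianE n m (A : 'M[R]_n) (B : 'M[R]_(n, m)) (X : 'M[R]_n) :
  hurwitz A -> A *m X + X *m A^T = - (B *m B^T) -> gramian A B = X.
Proof.
move=> hA AX; have [c [nu [c0 nu0 Enu]]] := hurwitz_decay hA.
pose E t := expmx (t *: A).
pose Q t := E t *m (B *m B^T) *m (E t)^T.
apply/matrixP => i j; rewrite mxE.
have QE s : expmx (s *: A) *m B *m B^T *m expmx (s *: A^T) = Q s.
  by rewrite expmx_tr /Q !mulmxA.
under eq_Rintegral do rewrite QE.
have dX (t : R) : is_derive t 1 (fun s => - (E s *m X *m (E s)^T)) (Q t).
  have := is_deriveN (is_derive_congruence A X t).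
  by rewrite AX mulmxN mulNmx opprK.
have dXij (t : R) :
    is_derive t 1 (fun s => (- (E s *m X *m (E s)^T)) i j) (Q t i j).
  exact: ((is_derive_mxP _ _ _).1 (dX t)).
have cE (t : R) : {for t, continuous E}.
  exact: is_derive_mx_continuous (is_derive_expmx A t).
have cQ : continuous (fun t => Q t i j).
  move=> t; have : {for t, continuous Q}.
    apply: cvg_mulmx; last by apply: cvg_trmx; exact: cE.
    by apply: cvg_mulmx; [exact: cE|exact: cvg_cst].
  by move/cvg_mxP; exact.
have Xl : (- (E t *m X *m (E t)^T)) i j @[t --> +oo] --> (0 : R).
  have : - (E t *m X *m (E t)^T) @[t --> +oo] --> - (0 : 'M[R]_n).
    by apply: cvgN; exact: cvg_congruence.
  by move/cvg_mxP/(_ i j); rewrite !mxE oppr0.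
have Qnu t : 0 <= t ->
    `|Q t i j| <= (n%:R * (n%:R * `|B *m B^T|) * (c * c)) *
    expR (- ((nu + nu) * t)).
  move=> t0; apply: le_trans (mx_norm_entry _ _ _) _.
  have Et := Enu t t0.
  rewrite /Q; apply: le_trans (mx_norm_mul _ _) _; rewrite mx_norm_tr.
  have -> : expR (- ((nu + nu) * t)) = expR (- (nu * t)) * expR (- (nu * t)).
    by rewrite -expRD; congr expR; ring.
  have h : `|E t *m (B *m B^T)| <= n%:R * (c * expR (- (nu * t))) * `|B *m B^T|.
    apply: le_trans (mx_norm_mul _ _) _.
    by rewrite ler_wpM2r// ler_wpM2l.
  apply: (@le_trans _ _ (n%:R * (n%:R * (c * expR (- (nu * t))) *
    `|B *m B^T|) * (c * expR (- (nu * t))))).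
    by apply: ler_pM => //; rewrite ?mulr_ge0// ler_wpM2l.
  by rewrite le_eqVlt; apply/orP; left; apply/eqP; ring.
rewrite (Rintegral_exp_dominated (addr_gt0 nu0 nu0) cQ dXij Qnu Xl).
by rewrite /E scale0r expmx0 mul1mx trmx1 mulmx1 mxE sub0r opprK.
Qed.

End Gramian.

(** * The closed loop on a finite horizon *)

(** Normalises an equation between sums of matrix products: products are
    distributed and frozen, and what remains is an identity in an abelian group,
    checked entrywise. *)
Ltac mx_abel :=
  rewrite ?(mulmxDl, mulmxDr, mulmxBl, mulmxBr, mulNmx, mulmxN, mulmxA,
            opprD, opprK, mul1mx, mulmx1);
  repeat match goal with
  | |- context [@mulmx ?K ?a ?b ?c ?M ?N] =>
      (* [move:] also abstracts the copies of the product that carry another,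
         convertible, ring structure; [generalize] would miss them. *)
      move: (@mulmx K a b c M N) => ?
  end;
  apply/matrixP => ? ?; rewrite !mxE; ring.

(** The closed loop on a horizon [T], in terms of the gap [Q] between the Riccati
    solution and the stabilizing one, the transition matrix [U], and the deviation
    [v] of the adjoint state from its steady value [ws]; [W] is only known as
    a symmetric solution of the Lyapunov equation. *)
Section FiniteHorizon.
Context {R : realType} {n : nat} (Ap G Delta W : 'M[R]_n) (ws v1 : 'cV[R]_n).
Hypothesis G_sym : G^T = G.
Hypothesis W_sym : W^T = W.
Hypothesis Delta_sym : Delta^T = Delta.
Hypothesis lyapW : Ap *m W + W *m Ap^T = - G.
Hypothesis Ap_unit : Ap \in unitmx.

Local Notation E t := (expmx (t *: Ap)).

(** The factor of [U] left after removing the free flow [e^(-tau Ap)], where [tau]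
    is the time to go. By the Lyapunov equation, the coefficient of [Delta] is the
    controllability Gramian over the times from [0] to [tau]. *)
Definition transition_core (tau : R) : 'M[R]_n :=
  1%:M + (W - E tau *m W *m (E tau)^T) *m Delta.

Context (T : R) (Q U : R -> 'M[R]_n) (v : R -> 'cV[R]_n).
Hypothesis dQ : forall t : R, t < T ->
  is_derive t 1 Q (- (Ap^T *m Q t + Q t *m Ap - Q t *m G *m Q t)).
Hypothesis cQ : Q t @[t --> T^'-] --> Q T.
Hypothesis QT : Q T = Delta.
Hypothesis dU : forall t : R, t < T ->
  is_derive t 1 U ((Ap - G *m Q t) *m U t).
Hypothesis cU : U t @[t --> T^'-] --> U T.
Hypothesis UT : U T = 1%:M.
Hypothesis dv : forall t : R, t < T ->
  is_derive t 1 v (- ((Ap^T - Q t *m G) *m v t) + Q t *m G *m ws).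
Hypothesis cv : v t @[t --> T^'-] --> v T.
Hypothesis vT : v T = v1.

(** The costate [Q U] no longer feels the feedback: the quadratic terms cancel. *)
Lemma costate_formula t : t < T -> Q t *m U t = (E (T - t))^T *m Delta.
Proof.
move=> tT.
have dV (s : R) : s < T ->
    is_derive s 1 (fun s => Q s *m U s) (- Ap^T *m (Q s *m U s)).
  move=> sT; apply: is_derive_eq (is_derive_mulmx (dQ sT) (dU sT)) _.
  mx_abel.
have cV : Q s *m U s @[s --> T^'-] --> Q T *m U T by exact: cvg_mulmx.
rewrite (linear_ode_left dV cV tT) QT UT mulmx1 -expmx_tr; congr (expmx _ *m _).
by rewrite scalerN -scaleNr opprB.
Qed.

(** Adding [W] times the costate to [U] removes the coupling term, by the Lyapunov
    equation, and leaves the flow of [Ap]. *)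
Lemma transition_formula t : t < T -> E (T - t) *m U t = transition_core (T - t).
Proof.
move=> tT.
pose Y s := U s + W *m (Q s *m U s).
have dY (s : R) : s < T -> is_derive s 1 Y (Ap *m Y s).
  move=> sT.
  have dV := is_derive_mulmx (dQ sT) (dU sT).
  apply: is_derive_eq (is_deriveD (dU sT) (is_derive_mulmxl W dV)) _.
  have -> : G = - (Ap *m W + W *m Ap^T) by rewrite lyapW opprK.
  rewrite /Y; mx_abel.
have cY : Y s @[s --> T^'-] --> Y T.
  by apply: cvgD => //; apply: cvg_mulmx; [exact: cvg_cst|exact: cvg_mulmx].
have := linear_ode_left dY cY tT.
rewrite /Y QT UT mulmx1 costate_formula// => /(congr1 (mulmx (E (T - t)))).
rewrite [RHS]mulmxA -(opprB T t) expmx_mulV mul1mx mulmxDr => /(canRL (addrK _)) ->.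
rewrite /transition_core; mx_abel.
Qed.

(** The existence of the Riccati solution forces invertibility: the costate formula
    expresses [Delta] as a left multiple of the core itself, so the identity is one
    too, and this exhibits a left inverse. *)
Lemma transition_core_unit t : t < T -> transition_core (T - t) \in unitmx.
Proof.
move=> tT; set K := transition_core _.
have UE : U t = E (- (T - t)) *m K.
  by rewrite /K -transition_formula// mulmxA expmx_mulN mul1mx.
have DE : Delta = (E (- (T - t)))^T *m Q t *m U t.
  rewrite -mulmxA costate_formula// mulmxA -trmx_mul expmx_mulV trmx1.
  by rewrite mul1mx.
pose L := 1%:M - (W - E (T - t) *m W *m (E (T - t))^T) *m
  ((E (- (T - t)))^T *m Q t *m E (- (T - t))).
have /mulmx1_unit[] // : L *m K = 1%:M.
rewrite /L mulmxBl mul1mx -(mulmxA _ _ K) -(mulmxA _ _ K) -UE -DE.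
by rewrite /K /transition_core addrK.
Qed.

Lemma transition_unit t : t < T -> U t \in unitmx.
Proof.
move=> tT; have := transition_core_unit tT.
by rewrite -transition_formula// unitmx_mul => /andP[].
Qed.

(** [U^T Q U] is an explicit symmetric matrix, and [U] is invertible. *)
Lemma riccati_gap_sym t : t < T -> (Q t)^T = Q t.
Proof.
move=> tT; have Uu := transition_unit tT.
have UtQU : (U t)^T *m (Q t *m U t) = Delta +
    Delta *m (W - E (T - t) *m W *m (E (T - t))^T) *m Delta.
  rewrite costate_formula// mulmxA -trmx_mul transition_formula//.
  rewrite /transition_core linearD/= trmx1 trmx_mul linearB/= !trmx_mul trmxK.
  rewrite W_sym Delta_sym; mx_abel.
have sym : ((U t)^T *m (Q t *m U t))^T = (U t)^T *m (Q t *m U t).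
  rewrite UtQU linearD/= !trmx_mul linearB/= !trmx_mul trmxK W_sym Delta_sym.
  by rewrite !mulmxA.
move: sym; rewrite !trmx_mul trmxK !mulmxA.
move=> /(congr1 (mulmx^~ (invmx (U t)))); rewrite !mulmxK//.
move=> /(congr1 (mulmx (invmx (U t)^T))); rewrite !mulKmx// ?unitmx_tr//.
Qed.

(** Symmetry of [Q] makes [U^T] an integrating factor for [v]; the forcing becomes
    [Delta e^((T - s) Ap) G ws], whose primitive is explicit. *)
Lemma adjoint_formula t : t < T ->
  (U t)^T *m v t = v1 + Delta *m invmx Ap *m (G *m ws - E (T - t) *m (G *m ws)).
Proof.
move=> tT.
pose f s := (U s)^T *m v s + Delta *m invmx Ap *m E (T - s) *m (G *m ws).
have df (s : R) : s < T -> is_derive s 1 f 0.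
  move=> sT.
  have dE := is_derive_mulmxr (G *m ws)
    (is_derive_mulmxl (Delta *m invmx Ap) (is_derive_expmx_sub Ap T s)).
  have dUv := is_derive_mulmx (is_derive_trmx (dU sT)) (dv sT).
  apply: is_derive_eq (is_deriveD dUv dE) _.
  have UQ : (U s)^T *m Q s = Delta *m E (T - s).
    rewrite -(riccati_gap_sym sT) -trmx_mul costate_formula// trmx_mul trmxK.
    by rewrite Delta_sym.
  rewrite trmx_mul linearB/= trmx_mul G_sym (riccati_gap_sym sT).
  rewrite mulmxN !mulmxA mulmxKV// -UQ; mx_abel.
have cf : f s @[s --> T^'-] --> f T.
  apply: cvgD; first by apply: cvg_mulmx => //; exact: cvg_trmx.
  apply: cvg_mulmx; last exact: cvg_cst.
  apply: cvg_mulmx; first exact: cvg_cst.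
  apply: cvg_at_left_filter.
  exact: is_derive_mx_continuous (is_derive_expmx_sub Ap T T).
have := is_derive0_constant_left df cf tT.
rewrite /f UT vT trmx1 mul1mx subrr scale0r expmx0 mulmx1 => /eqP.
rewrite -subr_eq0 => /eqP fE.
apply/eqP; rewrite -subr_eq0 -[X in _ == X]fE; apply/eqP; mx_abel.
Qed.

(** The decaying factor comes out on the left because [U = e^(-tau Ap) K]. *)
Lemma adjoint_decay_formula t : t < T ->
  v t = (E (T - t))^T *m (invmx (transition_core (T - t)))^T *m
    (v1 + Delta *m invmx Ap *m (G *m ws - E (T - t) *m (G *m ws))).
Proof.
move=> tT; rewrite -adjoint_formula// -transition_formula//.
pose z := invmx (E (T - t))^T *m v t.
have vz : v t = (E (T - t))^T *m z by rewrite mulKVmx// unitmx_tr expmx_unit.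
have Ku : (E (T - t) *m U t)^T \in unitmx.
  by rewrite unitmx_tr unitmx_mul expmx_unit transition_unit.
by rewrite vz (mulmxA (U t)^T) -(trmx_mul (E (T - t))) trmx_inv -[RHS]mulmxA mulKmx.
Qed.

End FiniteHorizon.

(** The Hamiltonian system with constant coefficients: [z] is autonomous, and
    [g + W z] follows the flow of [Ap] by the Lyapunov equation, so that [g] depends
    on the data through [z 0] alone. *)
Lemma decoupled_solution (R : realType) n (Ap G W : 'M[R]_n) (T : R)
    (g z : R -> 'cV[R]_n) :
  Ap *m W + W *m Ap^T = - G -> 0 < T ->
  (forall t : R, t < T -> is_derive t 1 g (Ap *m g t - G *m z t)) ->
  (forall t : R, t < T -> is_derive t 1 z (- Ap^T *m z t)) ->
  g 0 = 0 ->
  forall t, t < T ->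
    g t = (expmx (t *: Ap) *m W - W *m (expmx (- t *: Ap))^T) *m z 0.
Proof.
move=> lyapW T0 dg dz g0 t tT.
have dy (s : R) : s < T ->
    is_derive s 1 (fun s => g s + W *m z s) (Ap *m (g s + W *m z s)).
  move=> sT; have dWz := is_derive_mulmxl W (dz _ sT).
  apply: is_derive_eq (is_deriveD (dg _ sT) dWz) _.
  have -> : G = - (Ap *m W + W *m Ap^T) by rewrite lyapW opprK.
  mx_abel.
have zE := linear_ode dz T0 tT; have := linear_ode dy T0 tT.
rewrite g0 add0r !subr0 => /(canRL (addrK _)) ->; rewrite zE subr0.
rewrite -expmx_tr scalerN -scaleNr; mx_abel.
Qed.

(** * Exponential decay of the remainder *)

Lemma hurwitz_tr (R : realType) n (A : 'M[R]_n) : hurwitz A -> hurwitz A^T.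
Proof.
move=> hA z zA; apply: hA; move: zA.
rewrite !eigenvalue_root_char -map_trmx.
suff -> : forall M : 'M[R[i]]_n, char_poly M^T = char_poly M by [].
move=> M; rewrite /char_poly -det_tr; congr (\det _).
by apply/matrixP => i j; rewrite !mxE eq_sym.
Qed.

(** The transpose solves the Riccati equation as well, and the difference of the
    two solutions satisfies a homogeneous Lyapunov equation. *)
Lemma stabilizing_solution_sym (R : realType) n m k (A : 'M[R]_n)
    (B : 'M[R]_(n, m)) (C : 'M[R]_(k, n)) (X : 'M[R]_n) :
  stabilizing_solution A B C X -> X^T = X.
Proof.
move=> [are /hurwitz_tr hAp].
have areT : A^T *m X^T + X^T *m A - X^T *m B *m B^T *m X^T + C^T *m C = 0.
  rewrite -[RHS]trmx0 -are !(linearD, linearN) /= !trmx_mul !trmxK !mulmxA.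
  by rewrite [A^T *m X^T + _]addrC.
apply/eqP; rewrite -subr_eq0; apply/eqP/(lyapunov_inj hAp).
rewrite trmxK -[RHS](subrr 0) -[X in _ = X - _]areT -[X in _ = _ - X]are.
rewrite [(A - _)^T]linearB /= !trmx_mul trmxK; mx_abel.
Qed.

(** For [d] the difference between the optimal state and the homogeneous one, the
    remainder and the combined costate [z] satisfy the system of
    [decoupled_solution]: the time-dependent gap [Q] has disappeared. *)
Lemma hamiltonian_pair (R : realType) n (Ap G : 'M[R]_n) (ws xs : 'cV[R]_n)
    (Q : R -> 'M[R]_n) (d v : R -> 'cV[R]_n) (t : R) :
  is_derive t 1 Q (- (Ap^T *m Q t + Q t *m Ap - Q t *m G *m Q t)) ->
  is_derive t 1 d ((Ap - G *m Q t) *m d t - G *m v t - G *m ws) ->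
  is_derive t 1 v (- ((Ap^T - Q t *m G) *m v t) + Q t *m G *m ws) ->
  Ap *m xs = G *m ws ->
  let z s := Q s *m d s + v s in
  is_derive t 1 (fun s => d s - (xs - expmx (s *: Ap) *m xs))
    (Ap *m (d t - (xs - expmx (t *: Ap) *m xs)) - G *m z t) /\
  is_derive t 1 z (- Ap^T *m z t).
Proof.
move=> dQ dd dv xsE z; split.
  have dE := is_derive_mulmxr xs (is_derive_expmx Ap t).
  apply: is_derive_eq (is_deriveB dd (is_deriveB (is_derive_cst xs t 1) dE)) _.
  by rewrite /z !mulmxBr xsE; mx_abel.
apply: is_derive_eq (is_deriveD (is_derive_mulmx dQ dd) dv) _.
by rewrite /z; mx_abel.
Qed.

Lemma transition_core_continuous (R : realType) n (Ap Delta W : 'M[R]_n) :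
  continuous (transition_core Ap Delta W).
Proof.
move=> t; have cE : {for t, continuous (fun s : R => expmx (s *: Ap))}.
  exact: is_derive_mx_continuous (is_derive_expmx Ap t).
apply: cvgD; first exact: cvg_cst.
apply: cvg_mulmx; last exact: cvg_cst.
apply: cvgB; first exact: cvg_cst.
apply: cvg_mulmx; last exact: cvg_trmx.
by apply: cvg_mulmx => //; exact: cvg_cst.
Qed.

Lemma transition_core_cvg (R : realType) n (Ap Delta W : 'M[R]_n) :
  hurwitz Ap ->
  transition_core Ap Delta W t @[t --> +oo] --> 1%:M + W *m Delta.
Proof.
move=> hAp; have -> : 1%:M + W *m Delta = 1%:M + (W - 0) *m Delta by rewrite subr0.
apply: cvgD; first exact: cvg_cst.
apply: cvg_mulmx; last exact: cvg_cst.
by apply: cvgB; [exact: cvg_cst|exact: cvg_congruence].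
Qed.

Lemma adjoint_bound (R : realType) n (Ap N : 'M[R]_n) (gw v1 : 'cV[R]_n)
    (c mu cK : R) (v0 : R -> 'cV[R]_n) (K : R -> 'M[R]_n) :
  0 < c -> 0 < mu -> 0 < cK ->
  (forall t, 0 <= t -> `|expmx (t *: Ap)| <= c * expR (- (mu * t))) ->
  (forall t, 0 <= t -> `|invmx (K t)| <= cK) ->
  (forall t, 0 < t -> v0 t = (expmx (t *: Ap))^T *m (invmx (K t))^T *m
    (v1 + N *m (gw - expmx (t *: Ap) *m gw))) ->
  exists2 b, 0 < b & forall t, 0 < t -> `|v0 t| <= b * expR (- (mu * t)).
Proof.
move=> c0 mu0 cK0 Ec Kc v0E.
pose b1 := `|v1| + n%:R * `|N| * (`|gw| + n%:R * c * `|gw|).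
have b10 : 0 <= b1 by rewrite !(addr_ge0, mulr_ge0)// ltW.
exists (n%:R * (n%:R * c * cK) * b1 + 1) => [|t t0].
  by rewrite ltr_wpDl// !mulr_ge0// ltW.
have Et := Ec t (ltW t0); have Kt := Kc t (ltW t0).
have e0 := expR_gt0 (- (mu * t)).
have e1 : expR (- (mu * t)) <= 1.
  by rewrite -expR0 ler_expR oppr_le0 mulr_ge0// ltW.
have bt : `|v1 + N *m (gw - expmx (t *: Ap) *m gw)| <= b1.
  apply: le_trans (ler_normD _ _) _; rewrite lerD2l.
  apply: le_trans (mx_norm_mul _ _) _; rewrite ler_wpM2l ?mulr_ge0//.
  apply: le_trans (ler_normB _ _) _; rewrite lerD2l.
  apply: le_trans (mx_norm_mul _ _) _; rewrite ler_wpM2r// ler_wpM2l//.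
  by apply: le_trans Et _; rewrite ler_piMr// ltW.
have EKt : `|(expmx (t *: Ap))^T *m (invmx (K t))^T| <=
    n%:R * (c * expR (- (mu * t))) * cK.
  apply: le_trans (mx_norm_mul _ _) _; rewrite !mx_norm_tr.
  by rewrite ler_pM ?mulr_ge0// ler_wpM2l.
rewrite v0E//; apply: le_trans (mx_norm_mul _ _) _.
apply: (@le_trans _ _ (n%:R * (n%:R * (c * expR (- (mu * t))) * cK) * b1)).
  by rewrite ler_pM ?mulr_ge0// ler_wpM2l.
rewrite [leRHS]mulrDl mul1r ler_wpDr ?(ltW e0)//.
by rewrite le_eqVlt; apply/orP; left; apply/eqP; ring.
Qed.

Theorem proposition3p5 (R : realType) (n m k l : nat)
    (A : 'M[R]_n) (B : 'M[R]_(n, m)) (C : 'M[R]_(k, n)) (F : 'M[R]_(l, n))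
    (x0 : 'cV[R]_n) (yc : 'cV[R]_k) (ye : 'cV[R]_l) (Pp : 'M[R]_n)
    (P : R -> R -> 'M[R]_n) (w x : R -> R -> 'cV[R]_n) (U : R -> R -> 'M[R]_n)
    (g : R -> R -> 'cV[R]_n) :
  let S : 'M[R]_n := F^T *m F in
  let Ap : 'M[R]_n := A - B *m B^T *m Pp in
  let W : 'M[R]_n := gramian Ap B in
  let xs : 'cV[R]_n := invmx Ap *m B *m B^T *m invmx Ap^T *m C^T *m yc in
  let xh (t1 t : R) : 'cV[R]_n := U t1 t *m invmx (U t1 0) *m x0 in
  stabilizing_solution A B C Pp ->
  (forall t1 : R, 0 < t1 ->
     ode_sol_upto t1
       (fun _ X => - (A^T *m X + X *m A - X *m B *m B^T *m X + C^T *m C)) (P t1)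
     /\ P t1 t1 = S) ->
  (forall t1 : R, 0 < t1 ->
     ode_sol_upto t1
       (fun t v => - ((A^T - P t1 t *m B *m B^T) *m v - C^T *m yc)) (w t1)
     /\ w t1 t1 = - (F^T *m ye)) ->
  (forall t1 : R, 0 < t1 ->
     ode_sol_upto t1
       (fun t v => (A - B *m B^T *m P t1 t) *m v - B *m B^T *m w t1 t) (x t1)
     /\ x t1 0 = x0) ->
  (forall t1 : R, 0 < t1 ->
     ode_sol_upto t1 (fun t V => (A - B *m B^T *m P t1 t) *m V) (U t1)
     /\ U t1 t1 = 1%:M) ->
  (forall t1 t : R, 0 < t1 -> t <= t1 ->
     x t1 t = xh t1 t + xs
              - expmx (t *: Ap) *m invmx Ap *m B *m B^T *m invmx Ap^T *m C^T *m yc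
              + g t t1) ->
  1%:M + W *m (S - Pp) \in unitmx ->
  forall t : R, exists c mu : R,
    [/\ 0 < c, 0 < mu &
        forall t1 : R, Num.max 0 t < t1 -> `|g t t1| <= c * expR (- (mu * t1))].
Proof.
move=> S Ap W xs xh stab hP hw hx hU hg Wu t.
have Pp_sym := stabilizing_solution_sym stab.
have [are hAp] := stab; rewrite -/Ap in hAp.
pose G : 'M[R]_n := B *m B^T.
have G_sym : G^T = G by rewrite /G trmx_mul trmxK.
have [X AX] := lyapunov_solvable (- G) hAp.
have WX : W = X by exact: gramianE.
have lyapW : Ap *m W + W *m Ap^T = - G by rewrite WX.
have W_sym : W^T = W.
  by apply: (lyapunov_sym hAp _ lyapW); rewrite linearN/= G_sym.
pose Delta : 'M[R]_n := S - Pp.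
have Delta_sym : Delta^T = Delta.
  by rewrite /Delta linearB/= Pp_sym /S trmx_mul trmxK.
have Ap_unit := hurwitz_unitmx hAp.
have ApT : Ap^T = A^T - Pp *m B *m B^T.
  by rewrite /Ap linearB/= !trmx_mul trmxK Pp_sym !mulmxA.
pose ws : 'cV[R]_n := invmx Ap^T *m C^T *m yc.
have wsE : Ap^T *m ws = C^T *m yc.
  by rewrite /ws !mulmxA mulmxV ?mul1mx// unitmx_tr.
have xsE : Ap *m xs = G *m ws.
  by rewrite /xs /ws /G !mulmxA mulmxV ?mul1mx.
pose v1 : 'cV[R]_n := - (F^T *m ye) - ws.
pose Q t1 s : 'M[R]_n := P t1 s - Pp.
pose v t1 s : 'cV[R]_n := w t1 s - ws.
(* The algebraic Riccati equation eliminates [C^T C] from the differential one. *)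
have CC : C^T *m C = - (A^T *m Pp + Pp *m A - Pp *m B *m B^T *m Pp).
  by apply/eqP; rewrite -subr_eq0 opprK addrC; apply/eqP.
have dQ t1 : 0 < t1 -> forall s : R, s < t1 -> is_derive s 1 (Q t1)
    (- (Ap^T *m Q t1 s + Q t1 s *m Ap - Q t1 s *m G *m Q t1 s)).
  move=> /hP[[dP _] _] s /dP dPs.
  apply: is_derive_eq (is_deriveB dPs (is_derive_cst Pp s 1)) _.
  by rewrite CC ApT /Ap /Q /G; mx_abel.
have cQ t1 : 0 < t1 -> Q t1 s @[s --> t1^'-] --> Q t1 t1.
  move=> /hP[[_ /left_quotient_continuous cP] _].
  by apply: cvgB => //; exact: cvg_cst.
have QT t1 : 0 < t1 -> Q t1 t1 = Delta by move=> /hP[_ PS]; rewrite /Q PS.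
have dU t1 : 0 < t1 -> forall s : R, s < t1 ->
    is_derive s 1 (U t1) ((Ap - G *m Q t1 s) *m U t1 s).
  move=> /hU[[dU _] _] s /dU dUs; apply: is_derive_eq dUs _.
  by rewrite /Ap /Q /G; mx_abel.
have cU t1 : 0 < t1 -> U t1 s @[s --> t1^'-] --> U t1 t1.
  by move=> /hU[[_ /left_quotient_continuous]].
have UT t1 : 0 < t1 -> U t1 t1 = 1%:M by move=> /hU[].
have dv t1 : 0 < t1 -> forall s : R, s < t1 -> is_derive s 1 (v t1)
    (- ((Ap^T - Q t1 s *m G) *m v t1 s) + Q t1 s *m G *m ws).
  move=> /hw[[dw _] _] s /dw dws.
  apply: is_derive_eq (is_deriveB dws (is_derive_cst ws s 1)) _.
  by rewrite -wsE ApT /v /Q /G; mx_abel.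
have cv t1 : 0 < t1 -> v t1 s @[s --> t1^'-] --> v t1 t1.
  move=> /hw[[_ /left_quotient_continuous cw] _].
  by apply: cvgB => //; exact: cvg_cst.
have vT t1 : 0 < t1 -> v t1 t1 = v1 by move=> /hw[_ wT]; rewrite /v wT.
pose K := transition_core Ap Delta W.
have K_unit tau : 0 <= tau -> K tau \in unitmx.
  (* At [tau = 0] there is no horizon to appeal to, but the core is the identity. *)
  rewrite le_eqVlt => /predU1P[<-|tau0].
    rewrite /K /transition_core scale0r expmx0 mul1mx trmx1 mulmx1 subrr mul0mx.
    by rewrite addr0 unitmx1.
  have := transition_core_unit lyapW (dQ _ tau0) (cQ _ tau0) (QT _ tau0)
    (dU _ tau0) (cU _ tau0) (UT _ tau0) tau0.
  by rewrite subr0.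
have [cK cK0 Kbnd] := invmx_bounded
  (@transition_core_continuous _ _ Ap Delta W)
  (@transition_core_cvg _ _ Ap Delta W hAp)
  Wu K_unit.
have [c [mu [c0 mu0 Ebnd]]] := hurwitz_decay hAp.
have v0E t1 : 0 < t1 -> v t1 0 = (expmx (t1 *: Ap))^T *m (invmx (K t1))^T *m
    (v1 + Delta *m invmx Ap *m (G *m ws - expmx (t1 *: Ap) *m (G *m ws))).
  move=> t10.
  have := adjoint_decay_formula G_sym W_sym Delta_sym lyapW Ap_unit
    (dQ _ t10) (cQ _ t10) (QT _ t10) (dU _ t10) (cU _ t10) (UT _ t10)
    (dv _ t10) (cv _ t10) (vT _ t10) t10.
  by rewrite subr0.
have [b b0 vbnd] := adjoint_bound c0 mu0 cK0 Ebnd Kbnd v0E.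
pose M : 'M[R]_n := expmx (t *: Ap) *m W - W *m (expmx (- t *: Ap))^T.
have gE t1 : Num.max 0 t < t1 -> g t t1 = M *m v t1 0.
  rewrite gt_max => /andP[t10 tt1].
  pose d s := x t1 s - xh t1 s.
  have dd (s : R) : s < t1 ->
      is_derive s 1 d ((Ap - G *m Q t1 s) *m d s - G *m v t1 s - G *m ws).
    move=> st1; have [[dx _] _] := hx _ t10; have := dx _ st1 => dxs.
    have dxh := is_derive_mulmxr x0
      (is_derive_mulmxr (invmx (U t1 0)) (dU _ t10 _ st1)).
    apply: is_derive_eq (is_deriveB dxs dxh) _.
    by rewrite /d /xh /v /Ap /Q /G; mx_abel.
  pose z s := Q t1 s *m d s + v t1 s.
  pose gam s := d s - (xs - expmx (s *: Ap) *m xs).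
  have dgz s (st1 : s < t1) : is_derive s 1 gam (Ap *m gam s - G *m z s) /\
      is_derive s 1 z (- Ap^T *m z s).
    exact: hamiltonian_pair (dQ _ t10 _ st1) (dd _ st1) (dv _ t10 _ st1) xsE.
  have U0 : U t1 0 \in unitmx.
    exact: (transition_unit lyapW (dQ _ t10) (cQ _ t10) (QT _ t10)
      (dU _ t10) (cU _ t10) (UT _ t10) t10).
  have d0 : d 0 = 0.
    by rewrite /d /xh mulmxV// mul1mx (hx _ t10).2 subrr.
  have gam0 : gam 0 = 0.
    by rewrite /gam d0 scale0r expmx0 mul1mx !subrr.
  have := decoupled_solution lyapW t10 (fun s st1 => (dgz s st1).1)
    (fun s st1 => (dgz s st1).2) gam0 tt1.
  rewrite /z d0 mulmx0 add0r -/M => <-.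
  have Exs : expmx (t *: Ap) *m invmx Ap *m B *m B^T *m invmx Ap^T *m C^T *m yc
    = expmx (t *: Ap) *m xs by rewrite /xs !mulmxA.
  rewrite /gam /d (hg _ _ t10 (ltW tt1)) Exs.
  (* [xs] has a body, which [mxE] would unfold if it were not abstracted. *)
  move: (xh t1 t) (expmx _ *m xs) (g t t1); generalize xs => ? ? ? ?.
  by apply/matrixP => i j; rewrite !mxE; ring.
exists (n%:R * `|M| * b + 1), mu; split=> // [|t1 t1t].
  by rewrite ltr_wpDl// !mulr_ge0// ltW.
have t10 : 0 < t1 by move: t1t; rewrite gt_max => /andP[].
rewrite gE//; apply: le_trans (mx_norm_mul _ _) _.
rewrite mulrDl mul1r ler_wpDr ?expR_ge0// -[leRHS]mulrA ler_wpM2l ?mulr_ge0//.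
exact: vbnd.
Qed.
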